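(* With notation as below, the sequence $C$ given by $C_0=Q$, $C_1=\mathbb{F}_1\oplus\mathbb{G}_1$, $C_i=\mathbb{F}_i\oplus\mathbb{G}_i\oplus\mathbb{G}_{i-1}$ for $i\ge2$ (the last summand with internal degree shifted up by one), with differential $d_1(f,g)=\partial^{\mathbb{F}}(f)+\partial^{\mathbb{G}}(g)$, $d_2(f,g,h)=(\partial^{\mathbb{F}}f+\Phi_1(h),\ \partial^{\mathbb{G}}g-zh)$, and $d_i(f,g,h)=(\partial^{\mathbb{F}}f+\Phi_{i-1}(h),\ \partial^{\mathbb{G}}g-zh,\ -\partial^{\mathbb{G}}h)$ for $i\ge3$, is a complex and is the minimal $Q$-free resolution of $Q/I_\Gamma$. (Equivalently, $C$ is the mapping cone of the chain map $\Psi:\mathrm{Cone}(\mu^z)\to\mathbb{F}$ with $\Psi_0=(\partial^{\mathbb{G}}_1,0)$ and $\Psi_i=(0,\Phi_i)$ for $i>0$, where $\mu^z$ is multiplication by $z$ on $\Sigma^{-1}\mathbb{G}_{>0}$ and $\mathrm{Cone}(\mu^z)$ is the minimal free resolution of $J/zJ\cong I_\Gamma/I$.)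
   Context: Let $n\ge1$, $a_1,\ldots,a_n\ge0$, $Q=\Bbbk[z,x_1,\ldots,x_n,y_{i,j}\ (1\le i\le n,1\le j\le a_i)]$ over a field $\Bbbk$, $\Gamma$ the tree with edges $\{z,x_i\}$ and $\{x_i,y_{i,j}\}$ (every diameter-four tree can be labeled so), $I=(zx_1,\ldots,zx_n)$, $J=(x_iy_{i,j})$, $I_\Gamma=I+J$. Order $G(I)$ by $zx_i<zx_j$ iff $i<j$ and $G(J)$ by $x_iy_{i,\ell}<x_jy_{j,p}$ iff $i<j$, or $i=j$ and $\ell<p$. For a monomial ideal with ordered generating set and $U$ a set of generators, $m_U=\mathrm{lcm}(U)$; the Taylor resolution has basis $e_U$ in degree $|U|$ and differential $\partial(e_U)=\sum_{u\in U}(-1)^{|\{v\in U:v<u\}|}\frac{m_U}{m_{U\setminus\{u\}}}e_{U\setminus\{u\}}$. Let $\mathbb{F}$ (basis $f_V$, $V\subseteq G(I)$) and $\mathbb{G}$ (basis $g_W$, $W\subseteq G(J)$) be the Taylor resolutions of $Q/I$ and $Q/J$. For $W\subseteq G(J)$, let $W_z$ be the multiset $\{zx_i: x_iy_{i,j}\in W\}$ (ordered as in $W$), and $y_W=\mathrm{lcm}\{y_{i,j}:x_iy_{i,j}\in W\}$. Define $\Phi:\mathbb{G}\to\mathbb{F}$ by $\Phi_0(1)=z$ and $\Phi(g_W)=y_Wf_{W_z}$ for $W\ne\emptyset$, where $f_{W_z}:=0$ if some $zx_i$ occurs more than once in $W_z$; $\Phi$ is a chain map lifting $Q/J\xrightarrow{\cdot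 z}Q/I$. *)

(* Defs.v *)
From HB Require Import structures.
From mathcomp Require Import all_boot all_order all_algebra.
From mathcomp Require Import mpoly.

Set Implicit Arguments.
Unset Strict Implicit.
Unset Printing Implicit Defensive.

Import GRing.Theory.
Local Open Scope ring_scope.

(* Generic Taylor resolution of a monomial ideal in {mpoly k[N]}.          *)
(* Generators are indexed by a finite type G, totally ordered by [lt],    *)
(* with monomials [mon g : 'X_{1..N}].  Basis element e_U for U : {set G}, *)
(* in homological degree #|U|.                                            *)

Definition tlcm (N : nat) (G : finType) (mon : G -> 'X_{1..N}) (U : {set G})
  : 'X_{1..N} := \big[@mlcm N/0%MM]_(g in U) mon g.

(* coefficient of e_{U'} in the Taylor differential of e_U:
   sum over u in U with U' = U \ {u} of (-1)^{#{v in U : v < u}} m_U/m_{U\{u}} *)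
Definition taylor_coef (k : fieldType) (N : nat) (G : finType) (lt : rel G)
  (mon : G -> 'X_{1..N}) (U U' : {set G}) : {mpoly k[N]} :=
  \sum_(u in U | U' == U :\ u)
     (-1) ^+ #|[set v in U | lt v u]| * 'X_[(tlcm mon U - tlcm mon U')%MM].

(* indices (i,j) of the variables y_{i,j}, 1 <= j <= a_i (0-based here) *)
Definition Jidx (n : nat) (a : 'I_n -> nat) : finType := {i : 'I_n & 'I_(a i)}.

(* the variables of Q: None = z, Some (inl i) = x_i, Some (inr (i,j)) = y_{i,j} *)
Definition Var (n : nat) (a : 'I_n -> nat) : finType := option ('I_n + Jidx a).

Definition nvars (n : nat) (a : 'I_n -> nat) : nat := #|{: Var a}|.

Definition Qring (k : fieldType) (n : nat) (a : 'I_n -> nat) := {mpoly k[nvars a]}.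

Definition vmon (n : nat) (a : 'I_n -> nat) (v : Var a) : 'X_{1..nvars a} :=
  U_(enum_rank v)%MM.

Definition zV (n : nat) (a : 'I_n -> nat) : Var a := None.
Definition xV (n : nat) (a : 'I_n -> nat) (i : 'I_n) : Var a := Some (inl i).
Definition yV (n : nat) (a : 'I_n -> nat) (p : Jidx a) : Var a := Some (inr p).

Definition monI (n : nat) (a : 'I_n -> nat) (i : 'I_n) : 'X_{1..nvars a} :=
  (vmon (zV a) + vmon (xV a i))%MM.
Definition monJ (n : nat) (a : 'I_n -> nat) (p : Jidx a) : 'X_{1..nvars a} :=
  (vmon (@xV n a (tag p)) + vmon (@yV n a p))%MM.
Definition monY (n : nat) (a : 'I_n -> nat) (p : Jidx a) : 'X_{1..nvars a} :=
  vmon (@yV n a p).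

Definition ltI (n : nat) : rel 'I_n := fun i j => (i < j)%N.
Definition ltJ (n : nat) (a : 'I_n -> nat) : rel (Jidx a) :=
  fun p q => ((tag p < tag q)%N ||
              ((tag p == tag q) && (nat_of_ord (tagged p) < nat_of_ord (tagged q))%N)).

Definition dF (k : fieldType) (n : nat) (a : 'I_n -> nat) (V V' : {set 'I_n})
  : Qring k a := taylor_coef k (@ltI n) (monI a) V V'.
Definition dG (k : fieldType) (n : nat) (a : 'I_n -> nat) (W W' : {set Jidx a})
  : Qring k a := taylor_coef k (@ltJ n a) (@monJ n a) W W'.

(* The chain map Phi : G -> F in positive degrees: coefficient of f_V in Phi(g_W)
   is y_W if W_z (= {z x_i : x_i y_{i,j} in W}) has no repetition and equals V
   (its order as in W is increasing, so no sign), and 0 otherwise. *)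
Definition PhiC (k : fieldType) (n : nat) (a : 'I_n -> nat) (W : {set Jidx a})
  (V : {set 'I_n}) : Qring k a :=
  if ([set tag w | w in W] == V) && (#|V| == #|W|)
  then 'X_[tlcm (@monY n a) W] else 0.

(* The complex C.  Its basis (over all degrees) is indexed by              *)
(*   inl V        : f_V in F_{|V|}                     (V any subset)       *)
(*   inr (inl W)  : g_W in G_{|W|}                     (W nonempty)         *)
(*   inr (inr W)  : g_W in the summand G_{|W|} of C_{|W|+1} (W nonempty)     *)
(* so C_0 = F_0 = Q, C_1 = F_1 + G_1, C_i = F_i + G_i + G_{i-1} (i >= 2).   *)
(* G_0 is identified with C_0 = F_0 = Q (via f_emptyset) in d_1.            *)

Definition CB (n : nat) (a : 'I_n -> nat) : finType :=
  ({set 'I_n} + ({set Jidx a} + {set Jidx a}))%type.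

Definition CB_valid (n : nat) (a : 'I_n -> nat) (b : CB a) : bool :=
  match b with
  | inl _ => true
  | inr (inl W) => W != set0
  | inr (inr W) => W != set0
  end.

Definition CB_deg (n : nat) (a : 'I_n -> nat) (b : CB a) : nat :=
  match b with
  | inl V => #|V|
  | inr (inl W) => #|W|
  | inr (inr W) => #|W|.+1
  end.

(* dC b b' = coefficient of the basis element b' in d(b) *)
Definition dC (k : fieldType) (n : nat) (a : 'I_n -> nat) (b b' : CB a) : Qring k a :=
  match b, b' with
  | inl V, inl V' => @dF k n a V V'
  | inl _, _ => 0
  (* g-component: partial^G, with G_0 identified with C_0 *)
  | inr (inl W), inl V' => if V' == set0 then @dG k n a W set0 else 0
  | inr (inl W), inr (inl W') => if W' != set0 then @dG k n a W W' else 0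
  | inr (inl _), inr (inr _) => 0
  | inr (inr W), inl V' => @PhiC k n a W V'
  | inr (inr W), inr (inl W') => if W' == W then - 'X_[vmon (zV a)] else 0
  | inr (inr W), inr (inr W') => if W' != set0 then - @dG k n a W W' else 0
  end.

Definition Celt (k : fieldType) (n : nat) (a : 'I_n -> nat) := {ffun CB a -> Qring k a}.

Definition inDeg (k : fieldType) (n : nat) (a : 'I_n -> nat) (i : nat) (v : Celt k a) : Prop :=
  forall b, v b != 0 -> CB_valid b && (CB_deg b == i).

Definition dmap (k : fieldType) (n : nat) (a : 'I_n -> nat) (v : Celt k a) : Celt k a :=
  [ffun b' => \sum_(b : CB a) v b * dC k b b'].

Definition edge_mon (n : nat) (a : 'I_n -> nat) (e : ('I_n + Jidx a)%type) : 'X_{1..nvars a} :=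
  match e with inl i => @monI n a i | inr p => @monJ n a p end.

Definition in_IGamma (k : fieldType) (n : nat) (a : 'I_n -> nat) (p : Qring k a) : Prop :=
  exists c : {ffun ('I_n + Jidx a)%type -> Qring k a},
    p = \sum_(e : ('I_n + Jidx a)%type) c e * 'X_[@edge_mon n a e].

(* Main.v *)
Require Import Defs.
From HB Require Import structures.
From mathcomp Require Import all_boot all_order all_algebra.
From mathcomp Require Import mpoly.
Set Implicit Arguments.
Unset Strict Implicit.
Unset Printing Implicit Defensive.
Import GRing.Theory Num.Theory.
Local Open Scope ring_scope.

(** Multiplying the coefficient of e_U by m_U turns a Taylor differential into
    the boundary of the full simplex on the generators. This makes d^2 = 0
    formal, exhibits Phi as z times the simplicial pushforward along
    x_i y_ij |-> z x_i, and gives exactness multidegree by multidegree, since a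
    nonempty full simplex is contractible.

    Let (f, g, h) be a cycle of C in degree i >= 2. Then z dh = d(dg) = 0, so
    h = dh' for some h', and adding d(0, 0, h') kills h; what is left is a pair
    of cycles of F and G, which bound. In degree 1, df + dg = 0 forces z to
    divide dg; as z does not occur in the generators of J, the part of g
    divisible by z already carries all of dg, and the same reduction applies
    with z h' equal to that part. *)

(** * Boundary map of the full simplex *)

Section SimplexBoundary.

Variables (G : finType) (lt : rel G).
Implicit Types (U V : {set G}) (u w g : G).

Definition ssign U u : int := (-1) ^+ #|[set v in U | lt v u]|.

(** Matrix entry of the boundary of the full simplex on [G], with [set0] as augmentation face; it is
    an integer so that it can act on any abelian group. *)
Definition incidence U V : int := \sum_(u in U | V == U :\ u) ssign U u.

Lemma ssign_sq U u : ssign U u * ssign U u = 1.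
Proof. by rewrite /ssign -expr2 sqrr_sign. Qed.

Lemma ssignU1 U u w : u \notin U -> ssign (u |: U) w = ssign U w * (-1) ^+ lt u w.
Proof.
move=> uU; rewrite /ssign -exprD; congr (_ ^+ _).
have [luw | luw] := boolP (lt u w).
  have -> : [set v in u |: U | lt v w] = u |: [set v in U | lt v w].
    by apply/setP=> v; rewrite !inE; case: eqP => // ->; rewrite luw.
  by rewrite cardsU1 inE (negPf uU) addnC.
rewrite addn0; apply: eq_card => v; rewrite !inE.
by case: eqP => // ->; rewrite (negPf luw) !andbF.
Qed.

Lemma ssignD1 U u w : u \in U -> ssign U w = ssign (U :\ u) w * (-1) ^+ lt u w.
Proof. by move=> uU; rewrite -{1}(setD1K uU) ssignU1 // !inE eqxx. Qed.

Lemma sum_incidence_row (M : zmodType) (F : {set G} -> M) U :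
  \sum_V F V *~ incidence U V = \sum_(u in U) F (U :\ u) *~ ssign U u.
Proof.
under eq_bigr => V _ do rewrite mulrz_sumr.
rewrite (exchange_big_dep (mem U)) /=; last by move=> V u _ /andP[].
apply: eq_bigr => u uU; rewrite (big_pred1 (U :\ u)) //= => V.
by rewrite uU.
Qed.

Hypothesis lt_irr : irreflexive lt.
Hypothesis lt_asym : forall u w, u != w -> lt w u = ~~ lt u w.

Lemma ssignU1_id U u : u \notin U -> ssign (u |: U) u = ssign U u.
Proof. by move=> uU; rewrite ssignU1 // lt_irr mulr1. Qed.

Lemma sum_incidence_col (M : zmodType) (F : {set G} -> M) V :
  \sum_U F U *~ incidence U V = \sum_(u | u \notin V) F (u |: V) *~ ssign V u.
Proof.
under eq_bigr => U _ do rewrite mulrz_sumr.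
rewrite (exchange_big_dep (fun u => u \notin V)) /=; last first.
  by move=> U u _ /andP[uU /eqP->]; rewrite !inE eqxx.
apply: eq_bigr => u uV; rewrite (big_pred1 (u |: V)) ?ssignU1_id //= => U.
apply/andP/eqP => [[uU /eqP->] | ->]; first by rewrite setD1K.
by rewrite setU11 setU1K.
Qed.

Lemma lt_sign_swap u w : u != w -> (-1) ^+ lt w u = - (-1) ^+ lt u w :> int.
Proof. by move=> /lt_asym->; case: (lt u w); rewrite ?opprK. Qed.

(** Removing [u] then [w], or [w] then [u], reaches the same face with opposite signs. The sum thus
    equals its own negative, and the integers have no 2-torsion. *)
Lemma incidence_sq U V : \sum_W incidence U W * incidence W V = 0.
Proof.
pose F u w := ssign U u * ssign (U :\ u) w.
pose P u w := [&& u \in U, w \in U, u != w & V == U :\ u :\ w].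
have -> : \sum_W incidence U W * incidence W V
   = \sum_u \sum_(w | P u w) F u w.
  under eq_bigr => W _ do rewrite mulrC -mulrzz.
  rewrite sum_incidence_row [RHS](bigID (mem U)) /= [X in _ + X]big1 ?addr0.
    apply: eq_bigr => u uU; rewrite mulrzz mulr_suml; apply: eq_big => [w | w _].
      by rewrite /P uU !inE /= (eq_sym w) [in RHS]andbA (andbC (w \in U)).
    by rewrite mulrC.
  by move=> u uU; rewrite big_pred0 // => w; rewrite /P (negPf uU).
set S := LHS.
have SN : S = - S.
  rewrite {2}/S (exchange_big_dep xpredT) //= -sumrN /S; apply: eq_bigr => u _.
  rewrite -sumrN; apply: eq_big => [w|w /and4P[uU wU uw _]].
    by rewrite /P eq_sym setDDl setUC -setDDl; case: (u \in U); case: (w \in U).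
  have wUu : w \in U :\ u by rewrite !inE eq_sym uw.
  have uUw : u \in U :\ w by rewrite !inE uw.
  rewrite /F (ssignD1 u wU) (ssignD1 w uU).
  rewrite (lt_sign_swap uw) mulrN mulNr; congr (- _).
  by rewrite mulrAC [RHS]mulrAC; congr (_ * _); rewrite mulrC.
by apply/eqP; have := mulrn_eq0 S 2; rewrite mulr2n {1}SN addNr eqxx.
Qed.

(* Coning off the vertex g contracts the full simplex. *)
Lemma simplex_cone (M : zmodType) (t : {set G} -> M) g :
  (forall V, \sum_U t U *~ incidence U V = 0) ->
  forall V, \sum_(U : {set G}) (if g \in U then t (U :\ g) *~ ssign U g else 0)
              *~ incidence U V = t V.
Proof.
move=> tc V; rewrite sum_incidence_col; have [gV | gV] := boolP (g \in V).
  pose W := V :\ g.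
  have gW : g \notin W by rewrite !inE eqxx.
  have VE : V = g |: W by rewrite setD1K.
  (* The cycle condition at [W] expresses [t V] through the other cofaces of [W], which are then
     matched with the cofaces of [V]. *)
  have := tc W; rewrite sum_incidence_col (bigD1 g) //= -VE => /eqP.
  rewrite addr_eq0 => /eqP tV.
  rewrite -[RHS]mulr1z -(ssign_sq W g) mulrzA tV mulNrz mulrz_suml -sumrN.
  apply: eq_big => [u | u uV].
    by rewrite !inE negb_and negbK; case: (eqVneq u g) => [->|_]; rewrite ?gV ?andbT.
  have ug : u != g by apply: contraNneq uV => ->.
  have uW : u \notin W by rewrite !inE negb_and uV orbT.
  have -> : (u |: V) :\ g = u |: W.
    by apply/setP=> x; rewrite !inE; case: (eqVneq x u) => // ->; rewrite ug.
  rewrite !inE gV orbT -!mulrzA -mulrNz; congr (_ *~ _).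
  rewrite ssignU1 // (ssignD1 g gV) (ssignD1 u gV) -/W lt_irr mulr1 (lt_sign_swap ug).
  by rewrite mulrN mulrN mulrACA -expr2 sqrr_sign mulr1 mulrC.
rewrite (bigD1 g) //= big1 ?addr0 => [|u /andP[uV ug]].
  by rewrite setU11 setU1K // ssignU1_id // -mulrzA ssign_sq.
by rewrite !inE (negPf gV) eq_sym (negPf ug) mul0rz.
Qed.

End SimplexBoundary.

(** * Pushforward of chains along a map of vertices *)

Section SimplicialPushforward.

Variables (A B : finType) (ltA : rel A) (ltB : rel B) (phi : A -> B).
Implicit Types (W : {set A}) (V : {set B}).

(** The cardinality test makes [phi] injective on [W]: this is the 0/1 matrix of the simplicial
    pushforward, which kills collapsed simplices. *)
Definition transversal_over W V := (phi @: W == V) && (#|V| == #|W|).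

Hypothesis ltA_irr : irreflexive ltA.
Hypothesis ltA_asym : forall u w, u != w -> ltA w u = ~~ ltA u w.
Hypothesis phi_mono : forall u w, phi u != phi w -> ltA u w = ltB (phi u) (phi w).
Hypothesis ltB_irr : irreflexive ltB.

Lemma transversal_over_inj W V : transversal_over W V -> {in W &, injective phi}.
Proof. by case/andP=> /eqP <- /imset_injP. Qed.

(** Since [phi] is injective on [W] and monotone between distinct fibres, it carries the
    predecessors of [w] to those of [phi w]. *)
Lemma ssign_imset W w : {in W &, injective phi} -> w \in W ->
  ssign ltB (phi @: W) (phi w) = ssign ltA W w.
Proof.
move=> phi_inj wW; rewrite /ssign; congr (_ ^+ _).
have -> : [set v in phi @: W | ltB v (phi w)] = phi @: [set v in W | ltA v w].
  apply/setP=> v; rewrite !inE; apply/andP/imsetP.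
    case=> /imsetP[u uW ->] luw; exists u => //; rewrite inE uW /=.
    by rewrite phi_mono //; apply: contraTneq luw => ->; rewrite ltB_irr.
  case=> u; rewrite inE => /andP[uW luw] ->; rewrite imset_f //; split=> //.
  rewrite -phi_mono //; apply: contraTneq luw => /phi_inj-> //.
  by rewrite ltA_irr.
by rewrite card_in_imset // => u v; rewrite !inE => /andP[uW _] /andP[vW _]; apply: phi_inj.
Qed.

(* When two vertices of W lie over the same vertex, only the two faces omitting
   one of them can survive, and those cancel because no other vertex of W can
   separate them in the order. *)
Lemma pushforward_chain W V :
  \sum_V' (transversal_over W V')%:Z *~ incidence ltB V' V
    = \sum_W' (transversal_over W' V)%:Z *~ incidence ltA W W'.
Proof.
rewrite sum_incidence_row; have [/imset_injP phi_inj | ninj] := boolP (#|phi @: W| == #|W|).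
  rewrite (bigD1 (phi @: W)) //= big1 ?addr0 => [|V' /negPf V'W]; last first.
    by rewrite /transversal_over eq_sym V'W mul0rz.
  rewrite /transversal_over eqxx card_in_imset // eqxx /=.
  rewrite intz /incidence big_mkcondr /= big_imset //=; apply: eq_bigr => w wW.
  rewrite ssign_imset //.
  have -> : phi @: (W :\ w) = (phi @: W) :\ phi w.
    apply/setP=> v; rewrite !inE; apply/imsetP/andP.
      case=> u; rewrite !inE => /andP[uw uW] ->; rewrite imset_f //; split=> //.
      by apply: contra uw => /eqP/phi_inj->.
    case=> vw /imsetP[u uW uv]; exists u => //; rewrite !inE uW andbT.
    by apply: contraNneq vw => <-; rewrite uv.
  case: eqP => [->|/eqP nV]; last by rewrite eq_sym (negPf nV) mul0rz.
  rewrite eqxx /=.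
  have := cardsD1 w W; rewrite wW -(card_in_imset phi_inj) (cardsD1 (phi w)) imset_f //=.
  by move=> /eqP; rewrite eqSS => ->; rewrite intz.
rewrite big1 => [|V' _]; last first.
  rewrite /transversal_over; case: eqP => [<-|_]; last by rewrite mul0rz.
  by rewrite (negPf ninj) mul0rz.
have /dinjectivePn[w1 w1W [w2]] : ~~ dinjectiveb phi W.
  by apply: contra ninj => /dinjectiveP/imset_injP.
rewrite !inE => /andP[w21 w2W] e12; symmetry.
rewrite (bigD1 w1) //= (bigD1 w2) ?w2W //= big1 => [|w /andP[/andP[wW ww1] ww2]]; last first.
  case: (boolP (transversal_over _ _)) => [/transversal_over_inj inj|]; last by rewrite mul0rz.
  have := inj w1 w2; rewrite !inE w1W w2W (eq_sym w1) (eq_sym w2) ww1 ww2 e12.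
  by move=> /(_ isT isT erefl) E; rewrite E eqxx in w21.
rewrite addr0.
have eW : phi @: (W :\ w1) = phi @: (W :\ w2).
  apply/setP=> v; apply/imsetP/imsetP => -[u]; rewrite !inE => /andP[uw uW] ->.
    case: (eqVneq u w2) => [->|uw2]; last by exists u; rewrite // !inE uw2.
    by exists w1; rewrite // !inE eq_sym w21.
  case: (eqVneq u w1) => [->|uw1]; last by exists u; rewrite // !inE uw1.
  by exists w2; rewrite // !inE w21.
have cW : #|W :\ w1| = #|W :\ w2|.
  by have := cardsD1 w1 W; rewrite (cardsD1 w2 W) w1W w2W => -[].
have -> : transversal_over (W :\ w2) V = transversal_over (W :\ w1) V.
  by rewrite /transversal_over eW cW.
case: (boolP (transversal_over _ _)) => [/transversal_over_inj inj|]; last by rewrite !mul0rz.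
rewrite -mulrzDr; apply/eqP; rewrite mulrz_eq0; apply/orP; left.
have w2W1 : w2 \in W :\ w1 by rewrite !inE w21.
have w1W2 : w1 \in W :\ w2 by rewrite !inE eq_sym w21.
(* Both signs are reduced to [W] without [w1] and [w2]; the mutual comparison of these two vertices
   supplies the minus sign. *)
rewrite (ssignD1 _ w1 w1W) ltA_irr mulr1 (ssignD1 _ w1 w2W1).
rewrite (ssignD1 _ w2 w2W) ltA_irr mulr1 (ssignD1 _ w2 w1W2).
rewrite (lt_sign_swap ltA_asym w21) mulrN subr_eq0; apply/eqP; congr (_ * _).
rewrite setDDl setUC -setDDl /ssign; congr (_ ^+ _); apply: eq_card => v; rewrite !inE.
case: (eqVneq v w1) => //= vw1; case: (eqVneq v w2) => //= vw2.
case: (boolP (v \in W)) => //= vW.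
have nphi : phi v != phi w2.
  apply: contra vw2 => /eqP/inj; rewrite !inE vw1 vW w21 w2W => /(_ isT isT) ->//.
by rewrite !phi_mono ?e12.
Qed.

End SimplicialPushforward.

(** * Division by monomials, coefficient by coefficient *)

Section MonomialDivision.

Variables (R : idomainType) (N : nat).
Implicit Types (m mu : 'X_{1..N}) (p q : {mpoly R[N]}).

Lemma mpolyX_neq0 m : 'X_[m] != 0 :> {mpoly R[N]}.
Proof. by rewrite -msupp_eq0 msuppX. Qed.

Lemma mulXm_inj m : injective (fun p => 'X_[m] * p).
Proof. exact/mulfI/mpolyX_neq0. Qed.

Lemma mcoeffXm m p mu :
  ('X_[m] * p)@_mu = if (m <= mu)%MM then p@_(mu - m) else 0.
Proof.
case: ifP => [le | nle]; first by rewrite -{1}(submK le) addmC mulrC mcoeffMX.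
rewrite mulrC; apply/eqP; rewrite mcoeff_eq0 (perm_mem (msuppMX p m)).
by apply: contraFN nle => /mapP[m' _ ->]; rewrite lem_addr.
Qed.

(** The list [s] makes the support finite. This assembles a polynomial from choices made separately
    in each multidegree. *)
Lemma mpoly_of_coeffs m (s : seq 'X_{1..N}) (c : 'X_{1..N} -> R) :
  (forall mu, c mu != 0 -> (mu \in s) && (m <= mu)%MM) ->
  exists q, forall mu, ('X_[m] * q)@_mu = c mu.
Proof.
move=> cs; exists (\sum_(mu <- undup s | (m <= mu)%MM) c mu *: 'X_[(mu - m)%MM]) => mu.
rewrite mulr_sumr (eq_bigr (fun mu => c mu *: 'X_[mu])) => [|mu' le]; last first.
  by rewrite -scalerAr -mpolyXD addmC submK.
rewrite raddf_sum /=; have [c0 | cN0] := eqVneq (c mu) 0.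
  rewrite c0 big1 // => mu' _; rewrite mcoeffZ mcoeffX.
  by case: eqP => [->|_]; rewrite ?c0 ?mul0r ?mulr0.
have /andP[mus mmu] := cs _ cN0.
rewrite big_mkcond (bigD1_seq mu) ?mem_undup ?undup_uniq //= mmu big1 ?addr0.
  by rewrite mcoeffZ mcoeffX eqxx mulr1.
by move=> mu' /negPf nmu; rewrite mcoeffZ mcoeffX nmu mulr0 if_same.
Qed.

End MonomialDivision.

(** * Taylor complexes: square zero and exactness *)

Section TaylorComplex.

Variables (k : fieldType) (N : nat) (G : finType) (lt : rel G).
Variable mon : G -> 'X_{1..N}.
Implicit Types (U V : {set G}) (v : {set G} -> {mpoly k[N]}).

Local Notation tcoef := (taylor_coef k lt mon).

Definition taylor_diff v V := \sum_U v U * tcoef U V.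

Lemma tlcm_le U mu : (tlcm mon U <= mu)%MM = [forall g in U, (mon g <= mu)%MM].
Proof.
rewrite /tlcm (big_morph (fun m => (m <= mu)%MM) (id1 := true) (op1 := andb)).
- by rewrite big_andE.
- by move=> m1 m2; rewrite lem_mlcm.
- by apply/mnm_lepP=> i; rewrite mnm0E.
Qed.

Lemma mon_le_tlcm U g : g \in U -> (mon g <= tlcm mon U)%MM.
Proof. by have := lepm_refl (tlcm mon U); rewrite tlcm_le => /forall_inP; apply. Qed.

Lemma tlcm_subset U V : V \subset U -> (tlcm mon V <= tlcm mon U)%MM.
Proof.
by move=> /subsetP VU; rewrite tlcm_le; apply/forall_inP=> g /VU; apply: mon_le_tlcm.
Qed.

Lemma tlcm0 : tlcm mon set0 = 0%MM.
Proof. by rewrite /tlcm big_set0. Qed.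

(** For a face [V] of [U], m_V divides m_U, so the truncated subtraction of exponents is a true
    quotient. *)
Lemma taylor_coefX U V :
  'X_[tlcm mon V] * tcoef U V = 'X_[tlcm mon U] *~ incidence lt U V.
Proof.
rewrite /taylor_coef mulr_sumr mulrz_sumr; apply: eq_bigr => u /andP[uU /eqP VE].
rewrite mulrCA -mpolyXD addmC submK; last by rewrite tlcm_subset // VE subsetDl.
by rewrite -mulrzl /ssign rmorphXn /= mulrN1z.
Qed.

Lemma taylor_coef_eq0 U V : #|U| != #|V|.+1 -> tcoef U V = 0.
Proof.
move=> cU; rewrite /taylor_coef big_pred0 // => u; apply: contraNF cU.
by case/andP=> uU /eqP->; rewrite (cardsD1 u) uU.
Qed.

(* Rescaling the coefficient of e_U by m_U turns the Taylor differential into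
   the boundary map of the full simplex. *)
Lemma taylor_diffX v V :
  'X_[tlcm mon V] * taylor_diff v V
    = \sum_U ('X_[tlcm mon U] * v U) *~ incidence lt U V.
Proof.
rewrite /taylor_diff mulr_sumr; apply: eq_bigr => U _.
by rewrite mulrCA taylor_coefX mulrzAr mulrC.
Qed.

Lemma taylor_diffD v w V :
  taylor_diff (fun U => v U + w U) V = taylor_diff v V + taylor_diff w V.
Proof. by rewrite -big_split; apply: eq_bigr => U _; rewrite mulrDl. Qed.

Lemma taylor_diffM c v V : taylor_diff (fun U => c * v U) V = c * taylor_diff v V.
Proof. by rewrite mulr_sumr; apply: eq_bigr => U _; rewrite mulrA. Qed.

Lemma eq_taylor_diff v w : v =1 w -> taylor_diff v =1 taylor_diff w.
Proof. by move=> vw V; apply: eq_bigr => U _; rewrite vw. Qed.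

Hypothesis lt_irr : irreflexive lt.
Hypothesis lt_asym : forall u w, u != w -> lt w u = ~~ lt u w.

(** Cancelling m_V, as a domain permits, reduces this to the squared boundary of the simplex. *)
Lemma taylor_diff_sq v V : taylor_diff (taylor_diff v) V = 0.
Proof.
apply: (@mulXm_inj _ _ (tlcm mon V)); rewrite mulr0 taylor_diffX.
under eq_bigr => U _ do rewrite taylor_diffX mulrz_suml.
rewrite exchange_big /= big1 // => U _; under eq_bigr => W _ do rewrite -mulrzA.
by rewrite -mulrz_sumr incidence_sq.
Qed.

(* In multidegree mu the rescaled complex is the full simplex on the generators
   dividing mu, which is contracted by coning off one of them. *)
Lemma taylor_exact v : v set0 = 0 -> (forall V, taylor_diff v V = 0) ->
  exists w, (forall V, taylor_diff w V = v V) /\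
    (forall U, w U != 0 -> exists2 g, g \in U & v (U :\ g) != 0).
Proof.
move=> v0 vc.
(* The apex of the cone in multidegree [mu]. *)
pose g0 mu := [pick g | (mon g <= mu)%MM].
pose t U := 'X_[tlcm mon U] * v U.
pose c U mu : k := if g0 mu is Some g then
  if g \in U then (t (U :\ g))@_mu *~ ssign lt U g else 0 else 0.
have tE U mu : (t U)@_mu != 0 -> (tlcm mon U <= mu)%MM.
  by rewrite mcoeffXm; case: ifP; rewrite ?eqxx.
(* The cone coefficient vanishes unless m_U divides [mu]: the lcm of [U :\ g] does by [tE], and
   [mon g] does by choice of [g]. Hence it can be divided by m_U. *)
have /fin_all_exists[w wP] : forall U, exists q, forall mu, ('X_[tlcm mon U] * q)@_mu = c U mu.
  move=> U; apply: (@mpoly_of_coeffs _ _ _ (flatten [seq msupp (t (U :\ g)) | g : G])).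
  move=> mu; rewrite /c /g0; case: pickP => [g gmu|]; last by rewrite eqxx.
  case: ifP => gU; last by rewrite eqxx.
  move=> cN0; have tN0 : (t (U :\ g))@_mu != 0.
    by apply: contraNneq cN0 => ->; rewrite mul0rz.
  apply/andP; split.
    apply/flattenP; exists (msupp (t (U :\ g))); last by rewrite mcoeff_msupp.
    by apply/mapP; exists g; rewrite ?mem_enum.
  have := tE _ _ tN0; rewrite !tlcm_le => /forall_inP dv; apply/forall_inP=> h hU.
  by case: (eqVneq h g) => [->//|hg]; apply: dv; rewrite !inE hg.
exists w; split=> [V|U wU].
  apply: (@mulXm_inj _ _ (tlcm mon V)); rewrite taylor_diffX -/(t V).
  apply/mpolyP=> mu; rewrite raddf_sum /=.
  under eq_bigr => U _ do rewrite raddfMz /= wP.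
  rewrite /c; case g0E: (g0 mu) => [g|].
    apply: (simplex_cone lt_irr lt_asym (t := fun U => (t U)@_mu)) => V'.
    transitivity ((\sum_U t U *~ incidence lt U V')@_mu).
      by rewrite raddf_sum; apply: eq_bigr => U _; rewrite raddfMz.
    by rewrite -taylor_diffX vc mulr0 mcoeff0.
  (* No generator divides [mu], so only the face [set0] could contribute, and [v] vanishes there. *)
  rewrite big1 => [|U _]; last by rewrite mul0rz.
  have [->|[g gV]] := set_0Vmem V; first by rewrite /t v0 mulr0 mcoeff0.
  symmetry; apply/eqP; apply: contraTT isT => /tE; rewrite tlcm_le => /forall_inP/(_ g gV) gmu.
  by move: g0E; rewrite /g0; case: pickP => // /(_ g); rewrite gmu.
(* This support clause later fixes the homological degree of [w]. *)
apply/exists_inP; apply: contraNT wU => /exists_inPn vU0.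
apply/eqP/(@mulXm_inj _ _ (tlcm mon U))/mpolyP=> mu; rewrite wP mulr0 mcoeff0 /c.
case: (g0 mu) => // g; case: ifP => // /vU0; rewrite negbK /t => /eqP->.
by rewrite mulr0 mcoeff0 mul0rz.
Qed.

End TaylorComplex.

(** * Taylor complexes in low degree, and a minimality criterion *)

Lemma tlcm_val N (G : finType) (mon : G -> 'X_{1..N}) U j :
  tlcm mon U j = \max_(g in U) mon g j.
Proof.
rewrite /tlcm (big_morph (fun m : 'X_{1..N} => m j) (id1 := 0%N) (op1 := maxn)) //.
  by move=> m1 m2; rewrite mlcmE mnmDE mnmBE maxnE.
by rewrite mnm0E.
Qed.

Lemma tlcm1 N (G : finType) (mon : G -> 'X_{1..N}) g : tlcm mon [set g] = mon g.
Proof. by apply/mnmP=> j; rewrite tlcm_val big_set1. Qed.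

Section TaylorLowDegree.

Variables (k : fieldType) (N : nat) (G : finType) (lt : rel G).
Variable mon : G -> 'X_{1..N}.
Implicit Types (U V : {set G}) (v w : {set G} -> {mpoly k[N]}).

Local Notation tdiff := (taylor_diff lt mon).

(** The basis element at [set0] has zero boundary. The components of [dmap] can deviate at [set0]
    from the plain formulas, and this absorbs the deviation. *)
Lemma eq_taylor_diff_pos v w :
  (forall U, U != set0 -> v U = w U) -> tdiff v =1 tdiff w.
Proof.
move=> vw V; apply: eq_bigr => U _; have [->|/vw->//] := eqVneq U set0.
by rewrite taylor_coef_eq0 ?mulr0 // cards0.
Qed.

Lemma taylor_diff_deg i v V :
  (forall U, v U != 0 -> #|U| = i.+1) -> #|V| != i -> tdiff v V = 0.
Proof.
move=> vi Vi; rewrite /taylor_diff big1 // => U _.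
have [->|/vi Ui] := eqVneq (v U) 0; first by rewrite mul0r.
by rewrite taylor_coef_eq0 ?mulr0 // Ui eqSS eq_sym.
Qed.

(** If dropping any generator changes the lcm, every quotient of lcms in the differential is a
    nonconstant monomial. *)
Lemma taylor_coef_minimal U V :
  (forall u, u \in U -> tlcm mon U != tlcm mon (U :\ u)) ->
  (taylor_coef k lt mon U V)@_0%MM = 0.
Proof.
move=> Uu; rewrite raddf_sum big1 // => u /andP[uU /eqP->] /=.
rewrite -signr_odd mulr_sign; set m := (_ - _)%MM.
have m0 : (m == 0%MM) = false.
  apply: contraNF (Uu _ uU) => /eqP m0.
  by rewrite -(submK (tlcm_subset mon (subsetDl U [set u]))) -/m m0 add0m.
by case: (odd _); rewrite ?mcoeffN mcoeffX m0 ?oppr0.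
Qed.

Hypothesis lt_irr : irreflexive lt.

Lemma taylor_diff_set0 v : tdiff v set0 = \sum_g v [set g] * 'X_[mon g].
Proof.
have := taylor_diffX lt mon v set0; rewrite tlcm0 mpolyX0 mul1r => ->.
rewrite sum_incidence_col //; apply: eq_big => [u|u _]; first by rewrite inE.
rewrite setU0 tlcm1 mulrC /ssign.
by rewrite (_ : [set x in set0 | _] = set0) ?cards0 ?expr0 //; apply/setP=> x; rewrite !inE.
Qed.

(* Division of v by X_j with remainder: the remainder does not involve X_j, nor
   does its boundary, so that boundary must vanish. *)
Lemma taylor_diff_div (j : 'I_N) v q : (forall g, mon g j = 0%N) ->
  tdiff v set0 = 'X_[U_(j)] * q ->
  exists w, (forall U, w U != 0 -> v U != 0) /\
    'X_[U_(j)] * tdiff w set0 = tdiff v set0.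
Proof.
move=> monj vq.
(* [w U] collects the terms of [v U] divisible by X_j, divided by X_j. *)
have /fin_all_exists[w wP] : forall U, exists r, forall mu,
    ('X_[U_(j)] * r)@_mu = if (U_(j) <= mu)%MM then (v U)@_mu else 0.
  move=> U; apply: (@mpoly_of_coeffs _ _ _ (msupp (v U))) => mu.
  by case: ifP; rewrite ?eqxx // -mcoeff_msupp => _ ->.
exists w; split=> [U|].
  apply: contraNneq => vU; apply/eqP/(@mulXm_inj _ _ U_(j)%MM)/mpolyP=> mu.
  by rewrite wP vU mulr0 mcoeff0 if_same.
apply/mpolyP=> mu; have [mu0|muN0] := boolP (U_(j) <= mu)%MM; last first.
  by rewrite vq !mcoeffXm (negPf muN0).
rewrite !taylor_diff_set0 mulr_sumr !raddf_sum; apply: eq_bigr => g _ /=.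
(* Multiplication by a generator free of X_j does not change which terms X_j divides. *)
rewrite mulrA !(mulrC _ 'X_[mon g]) !(mcoeffXm (mon g)); case: ifP => // _; rewrite wP.
by rewrite lep1mP mnmBE monj subn0 -lep1mP mu0.
Qed.

End TaylorLowDegree.

Lemma bigmax_bool (I : finType) (A : {set I}) (b : I -> bool) :
  \max_(i in A) (b i : nat) = [exists i in A, b i].
Proof.
case: existsP => [[i /andP[iA bi]]|nb]; last first.
  by rewrite big1 // => i iA; case: (boolP (b i)) => // bi; case: nb; exists i; rewrite iA.
apply/eqP; rewrite eqn_leq; apply/andP; split.
  by apply/bigmax_leqP=> x _; case: (b x).
by rewrite (bigD1 i) //= bi leq_maxl.
Qed.

(** * Generators of I and J: their orders and lcms *)

Section DiameterFourTree.

Variables (k : fieldType) (n : nat) (a : 'I_n -> nat).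
Implicit Types (V : {set 'I_n}) (W : {set Jidx a}).

Local Notation z := ('X_[vmon (zV a)] : Qring k a).
Local Notation DF := (taylor_diff (@ltI n) (monI a) (k := k)).
Local Notation DG := (taylor_diff (@ltJ n a) (@monJ n a) (k := k)).

Lemma ltI_irr : irreflexive (@ltI n).
Proof. by move=> i; rewrite /ltI ltnn. Qed.

Lemma ltI_asym (u w : 'I_n) : u != w -> ltI w u = ~~ ltI u w.
Proof. by move=> uw; rewrite /ltI -leqNgt ltn_neqAle val_eqE eq_sym uw. Qed.

Lemma ltJ_irr : irreflexive (@ltJ n a).
Proof. by move=> i; rewrite /ltJ !ltnn andbF. Qed.

(** This is the monotonicity between fibres that the pushforward along x_i y_{i,j} -> z x_i
    requires. *)
Lemma tag_mono (u w : Jidx a) : tag u != tag w -> ltJ u w = ltI (tag u) (tag w).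
Proof. by rewrite /ltJ => /negPf->; rewrite orbF. Qed.

Lemma ltJ_asym (u w : Jidx a) : u != w -> ltJ w u = ~~ ltJ u w.
Proof.
have [uw|tuw] := eqVneq (tag u) (tag w); last first.
  by rewrite tag_mono 1?eq_sym // tag_mono // => _; apply: ltI_asym.
case: u w uw => [i x] [j y] /= ij; case: _ / ij y => y.
rewrite /ltJ /= eqxx ltnn -leqNgt ltn_neqAle val_eqE => xy.
by rewrite (_ : y != x) //; apply: contra xy => /eqP->.
Qed.

Lemma vmonE (v v' : Var a) : vmon v (enum_rank v') = (v == v').
Proof. by rewrite /vmon mnm1E (inj_eq enum_rank_inj). Qed.

(** The generators are squarefree, so the exponents of an lcm are indicators. *)
Lemma tlcm_monI V v : tlcm (monI a) V (enum_rank v) =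
  match v with None => V != set0 | Some (inl i) => i \in V | _ => false end.
Proof.
rewrite tlcm_val; under eq_bigr => i _ do rewrite mnmDE !vmonE.
case: v => [[i|p]|] /=.
- under eq_bigr => j _ do rewrite add0n. rewrite bigmax_bool; congr nat_of_bool.
  apply/existsP/idP => [[j /andP[jV /eqP[<-]]]//|iV].
  by exists i; rewrite iV eqxx.
- by rewrite big1.
rewrite (bigmax_bool V xpredT); congr nat_of_bool.
by apply/existsP/set0Pn => -[i]; rewrite ?andbT => iV; exists i; rewrite ?iV.
Qed.

Lemma tlcm_monJ W v : tlcm (@monJ n a) W (enum_rank v) =
  match v with None => false | Some (inl i) => i \in [set tag w | w in W]
             | Some (inr p) => p \in W end.
Proof.
rewrite tlcm_val; under eq_bigr => i _ do rewrite mnmDE !vmonE.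
case: v => [[i|p]|] /=.
- under eq_bigr => j _ do rewrite addn0. rewrite bigmax_bool; congr nat_of_bool.
  apply/existsP/imsetP => [[j /andP[jV /eqP[<-]]]|[j jW ->]]; first by exists j.
  by exists j; rewrite jW eqxx.
- under eq_bigr => j _ do rewrite add0n. rewrite bigmax_bool; congr nat_of_bool.
  apply/existsP/idP => [[j /andP[jW /eqP[<-]]]//|pW].
  by exists p; rewrite pW eqxx.
by rewrite big1.
Qed.

Lemma tlcm_monY W v : tlcm (@monY n a) W (enum_rank v) =
  if v is Some (inr p) then p \in W else false.
Proof.
rewrite tlcm_val; under eq_bigr => i _ do rewrite vmonE.
case: v => [[i|p]|] /=; try by rewrite big1.
rewrite bigmax_bool; congr nat_of_bool.
apply/existsP/idP => [[j /andP[jW /eqP[<-]]]//|pW].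
by exists p; rewrite pW eqxx.
Qed.

(** * The chain map Phi *)

Local Notation over := (transversal_over (@tag 'I_n (fun i => 'I_(a i)))).

(** When V = W_z without repetition, both sides are the product of z, the x_i in V and y_W. [W] must
    be nonempty: on [set0], [set0] the value of [PhiC] is 1, whereas Phi_0(1) = z. *)
Lemma PhiCX W V : W != set0 ->
  'X_[tlcm (monI a) V] * PhiC k W V = (z * 'X_[tlcm (@monJ n a) W]) *~ (over W V)%:Z.
Proof.
move=> W0; rewrite /PhiC -/(over W V); case: ifP => [|_]; last by rewrite mulr0.
case/andP=> /eqP WV cVW; rewrite mulr1z -!mpolyXD; congr 'X_[_]; apply/mnmP=> j; rewrite -(enum_valK j).
rewrite !mnmDE tlcm_monI tlcm_monJ tlcm_monY vmonE.
case: (enum_val j) => [[i|p]|] //=; first by rewrite WV addn0.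
by rewrite -cards_eq0 (eqP cVW) cards_eq0 W0.
Qed.

Definition Phi (h : {set Jidx a} -> Qring k a) V := \sum_W h W * PhiC k W V.

Lemma PhiC_eq0 W V : #|V| != #|W| -> PhiC k W V = 0.
Proof. by rewrite /PhiC andbC => /negPf->. Qed.

Lemma eq_Phi_pos h h' V : V != set0 ->
  (forall W, W != set0 -> h W = h' W) -> Phi h V = Phi h' V.
Proof.
move=> V0 hh; apply: eq_bigr => W _; have [->|/hh->//] := eqVneq W set0.
by rewrite PhiC_eq0 ?mulr0 // cards0 cards_eq0.
Qed.

Lemma Phi_set0 h : h set0 = 0 -> Phi h set0 = 0.
Proof.
move=> h0; apply: big1 => W _; have [->|W0] := eqVneq W set0; first by rewrite h0 mul0r.
by rewrite PhiC_eq0 ?mulr0 // cards0 eq_sym cards_eq0.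
Qed.

Lemma PhiM c h V : Phi (fun W => c * h W) V = c * Phi h V.
Proof. by rewrite mulr_sumr; apply: eq_bigr => W _; rewrite mulrA. Qed.

(** After rescaling, Phi is [z] times the pushforward, so [pushforward_chain] applies. The summand
    [W = set0] on the right accounts for Phi_0(1) = z. *)
Lemma Phi_chainX h V : h set0 = 0 ->
  'X_[tlcm (monI a) V] * DF (Phi h) V
    = z * \sum_W ('X_[tlcm (@monJ n a) W] * DG h W) *~ (over W V)%:Z.
Proof.
move=> h0; rewrite taylor_diffX.
transitivity (\sum_V' \sum_W (h W * (z * 'X_[tlcm (@monJ n a) W]))
                *~ ((over W V')%:Z *~ incidence (@ltI n) V' V)).
  apply: eq_bigr => V' _; rewrite mulr_sumr mulrz_suml; apply: eq_bigr => W _.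
  rewrite mulrCA; have [->|W0] := eqVneq W set0; first by rewrite h0 !mul0r !mul0rz.
  by rewrite PhiCX // mulrzAr mulrzz mulrzA.
rewrite exchange_big /= mulr_sumr.
transitivity (\sum_W \sum_W' (z * ('X_[tlcm (@monJ n a) W'] * h W'))
                *~ ((over W V)%:Z *~ incidence (@ltJ n a) W' W)).
  rewrite [RHS]exchange_big /=; apply: eq_bigr => W _; rewrite -!mulrz_sumr.
  rewrite (pushforward_chain ltJ_irr ltJ_asym tag_mono ltI_irr); congr (_ *~ _).
  by rewrite mulrC -mulrA.
apply: eq_bigr => W _; rewrite taylor_diffX mulrz_suml mulr_sumr.
by apply: eq_bigr => W' _; rewrite mulrzz (mulrC (over W V)%:Z) mulrzA !mulrzAr.
Qed.

Lemma Phi_chain h V : h set0 = 0 -> V != set0 -> DF (Phi h) V = Phi (DG h) V.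
Proof.
move=> h0 V0; apply: (@mulXm_inj _ _ (tlcm (monI a) V)).
rewrite Phi_chainX // !mulr_sumr; apply: eq_bigr => W _.
have [->|W0] := eqVneq W set0; last by rewrite mulrCA PhiCX // !mulrzAr mulrA mulrC.
rewrite /PhiC /transversal_over imset0 (eq_sym set0) (negPf V0) /=.
by rewrite mulr0z !mulr0.
Qed.

Lemma Phi_chain0 h : h set0 = 0 -> DF (Phi h) set0 = z * DG h set0.
Proof.
move=> h0; have := Phi_chainX set0 h0; rewrite !tlcm0 mpolyX0 mul1r => ->.
congr (_ * _); rewrite (bigD1 set0) //= big1 ?addr0 => [|W W0].
  by rewrite tlcm0 mpolyX0 mul1r /transversal_over imset0 !cards0 !eqxx mulr1z.
by rewrite /transversal_over cards0 eq_sym (eq_sym 0%N) cards_eq0 (negPf W0) andbF mulr0z.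
Qed.

(** * The differential of C in components, and its square *)

Implicit Types (v : Celt k a).

Local Notation fpart v := (fun V => v (inl V)).
Local Notation gpart v := (fun W => v (inr (inl W))).
Local Notation hpart v := (fun W => v (inr (inr W))).

Lemma dmap_f v V : dmap v (inl V) =
  DF (fpart v) V + (if V == set0 then DG (gpart v) set0 else 0) + Phi (hpart v) V.
Proof.
rewrite ffunE big_sumType big_sumType /= addrA; congr (_ + _ + _).
by case: eqP => // _; apply: big1 => W _; rewrite mulr0.
Qed.

Lemma dmap_g v W : dmap v (inr (inl W)) =
  (if W != set0 then DG (gpart v) W else 0) - z * hpart v W.
Proof.
rewrite ffunE big_sumType big_sumType /= big1 ?add0r => [|V _]; last by rewrite mulr0.
congr (_ + _); first by case: ifP => // _; apply: big1 => W' _; rewrite mulr0.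
rewrite (bigD1 W) //= eqxx big1 ?addr0 ?mulrN 1?mulrC // => W' /negPf WW'.
by rewrite eq_sym WW' mulr0.
Qed.

Lemma dmap_h v W : dmap v (inr (inr W)) =
  if W != set0 then - DG (hpart v) W else 0.
Proof.
rewrite ffunE big_sumType big_sumType /= big1 ?add0r => [|V _]; last by rewrite mulr0.
rewrite big1 ?add0r => [|V _]; last by rewrite mulr0.
case: ifP => _; last by apply: big1 => W' _; rewrite mulr0.
by rewrite -sumrN; apply: eq_bigr => W' _; rewrite mulrN.
Qed.

Lemma dC_deg (b b' : CB a) :
  CB_valid b -> dC k b b' != 0 -> CB_valid b' && (CB_deg b == (CB_deg b').+1).
Proof.
have dF0 V V' : dF k a V V' != 0 -> #|V| == #|V'|.+1.
  by apply: contraNT => cV; rewrite /dF taylor_coef_eq0.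
have dG0 W W' : dG k W W' != 0 -> #|W| == #|W'|.+1.
  by apply: contraNT => cW; rewrite /dG taylor_coef_eq0.
case: b b' => [V|[W|W]] [V'|[W'|W']] //=; rewrite ?eqxx // => W0.
- exact: dF0.
- by case: ifP => [/eqP-> /dG0|_]; rewrite ?cards0 ?eqxx.
- by case: ifP => [_ /dG0|_]; rewrite ?eqxx.
- by rewrite eqSS; apply: contraNT => cW; rewrite PhiC_eq0 // eq_sym.
- by case: (eqVneq W' W) => [->|_]; rewrite ?eqxx ?W0.
- by case: ifP => [_|_]; rewrite ?eqxx // oppr_eq0 => /dG0; rewrite eqSS.
Qed.

Lemma dmap_deg i v : inDeg i.+1 v -> inDeg i (dmap v).
Proof.
move=> vi b'; apply: contraNT => nb'; rewrite ffunE big1 // => b _.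
have [->|vb] := eqVneq (v b) 0; first by rewrite mul0r.
have /andP[bv /eqP bi] := vi _ vb.
have [->|db] := eqVneq (dC k b b') 0; first by rewrite mulr0.
by have := dC_deg bv db; rewrite bi eqSS eq_sym (negPf nb').
Qed.

Lemma inDeg_gpart0 i v : inDeg i v -> v (inr (inl set0)) = 0.
Proof. by move=> vi; apply/eqP/negPn/negP=> /vi /=; rewrite eqxx. Qed.

Lemma inDeg_hpart0 i v : inDeg i v -> v (inr (inr set0)) = 0.
Proof. by move=> vi; apply/eqP/negPn/negP=> /vi /=; rewrite eqxx. Qed.

Lemma dmap_sq i v : inDeg i v -> dmap (dmap v) = 0.
Proof.
move=> vi; have h0 := inDeg_hpart0 vi.
have Gg W : DG (gpart (dmap v)) W = - (z * DG (hpart v) W).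
  rewrite (@eq_taylor_diff_pos _ _ _ _ _ _
            (fun W => DG (gpart v) W + - z * hpart v W)) => [|W' W'0].
    by rewrite taylor_diffD taylor_diffM (taylor_diff_sq _ ltJ_asym) add0r mulNr.
  by rewrite dmap_g W'0 mulNr.
have Ff V : DF (fpart (dmap v)) V = DF (Phi (hpart v)) V.
  rewrite (@eq_taylor_diff_pos _ _ _ _ _ _
            (fun V => DF (fpart v) V + Phi (hpart v) V)) => [|V' V'0].
    by rewrite taylor_diffD (taylor_diff_sq _ ltI_asym) add0r.
  by rewrite dmap_f (negPf V'0) addr0.
have Hh W : W != set0 -> hpart (dmap v) W = - 1 * DG (hpart v) W.
  by move=> W0; rewrite dmap_h W0 mulN1r.
apply/ffunP=> -[V|[W|W]]; rewrite [RHS]ffunE ?dmap_f ?dmap_g ?[LHS]dmap_h.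
(* At [set0] the term z dh arriving through F_1 cancels the one arriving through G_1; elsewhere Phi
   commutes with the boundaries. *)
- rewrite Ff; have [->|V0] := eqVneq V set0.
    by rewrite Phi_chain0 // Gg subrr add0r Phi_set0 // dmap_h eqxx.
  by rewrite addr0 (eq_Phi_pos V0 Hh) PhiM Phi_chain // mulN1r subrr.
- rewrite dmap_h; case: ifP => W0; last by rewrite mulr0 subrr.
  by rewrite Gg mulrN opprK addNr.
- case: ifP => // W0; rewrite (eq_taylor_diff_pos _ _ Hh) taylor_diffM.
  by rewrite (taylor_diff_sq _ ltJ_asym) mulr0 oppr0.
Qed.

(** * Homology in degree zero *)

Lemma dmap_deg1 v (p : Qring k a) : inDeg 1 v ->
  (dmap v = [ffun b => if b == inl set0 then p else 0]) <->
  (p = \sum_i v (inl [set i]) * 'X_[monI a i]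
       + \sum_j v (inr (inl [set j])) * 'X_[monJ j]).
Proof.
move=> v1; have h0 := inDeg_hpart0 v1.
have dv0 : dmap v (inl set0) = \sum_i v (inl [set i]) * 'X_[monI a i]
       + \sum_j v (inr (inl [set j])) * 'X_[monJ j].
  rewrite dmap_f eqxx Phi_set0 // addr0 (taylor_diff_set0 _ ltI_irr).
  by rewrite (taylor_diff_set0 _ ltJ_irr).
split=> [E|->]; first by rewrite -dv0 E ffunE eqxx.
(* All coordinates other than [inl set0] vanish for degree reasons. *)
apply/ffunP=> b; rewrite [RHS]ffunE; case: eqP => [->|/eqP b0]; first exact: dv0.
apply/eqP; apply: contraNT b0 => /(dmap_deg v1).
case: b => [V|[W|W]] //=; first by rewrite cards_eq0 => /eqP->.
  by rewrite cards_eq0; case: eqP.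
by case/andP.
Qed.

Lemma image_d1 (p : Qring k a) : in_IGamma p <->
  exists v : Celt k a, inDeg 1 v /\ dmap v = [ffun b => if b == inl set0 then p else 0].
Proof.
split=> [[c ->]|[v [v1 /(dmap_deg1 _ v1)->]]]; last first.
  exists [ffun e => match e with inl i => v (inl [set i])
                               | inr j => v (inr (inl [set j])) end].
  by rewrite big_sumType; congr (_ + _); apply: eq_bigr => i _; rewrite ffunE.
(* Each sum has at most one term: the edge coefficients sit on singletons and are extended by 0. *)
pose v : Celt k a := [ffun b => match b with
  | inl V => \sum_(i | V == [set i]) c (inl i)
  | inr (inl W) => \sum_(j | W == [set j]) c (inr j)
  | inr (inr _) => 0 end].
have v1 : inDeg 1 v.
  move=> [V|[W|W]]; rewrite ffunE /= ?eqxx //.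
    apply: contraNT => V1; rewrite big_pred0 // => i; apply: contraNF V1 => /eqP->.
    by rewrite cards1.
  apply: contraNT => W1; rewrite big_pred0 // => i; apply: contraNF W1 => /eqP->.
  by rewrite cards1 -cards_eq0 cards1.
exists v; split=> //; apply/(dmap_deg1 _ v1); rewrite big_sumType; congr (_ + _).
  apply: eq_bigr => i _; rewrite ffunE (big_pred1 i) // => i'.
  by rewrite (inj_eq set1_inj) eq_sym.
apply: eq_bigr => i _; rewrite ffunE (big_pred1 i) // => i'.
by rewrite (inj_eq set1_inj) eq_sym.
Qed.

(** * Exactness in positive degrees *)

Lemma monJ_z (p : Jidx a) : monJ p (enum_rank (zV a)) = 0%N.
Proof. by rewrite mnmDE !vmonE. Qed.

(* Up to sign, h is the component in the last summand of a preimage of v. *)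
Lemma lift_hpart i v : inDeg i.+1 v -> dmap v = 0 ->
  exists h : {set Jidx a} -> Qring k a,
    [/\ forall W, h W != 0 -> #|W| = i.+1,
        forall W, W != set0 -> DG h W = hpart v W
      & z * DG h set0 = DG (gpart v) set0].
Proof.
move=> vi v0; have h0 := inDeg_hpart0 vi.
have gdeg W : gpart v W != 0 -> #|W| = i.+1 by case/vi/andP=> _ /eqP.
have hdeg W : hpart v W != 0 -> #|W| = i by case/vi/andP=> _ /eqP[].
have vc b : dmap v b = 0 by rewrite v0 ffunE.
case: i vi gdeg hdeg => [|i] vi gdeg hdeg.
  have := vc (inl set0); rewrite dmap_f eqxx Phi_set0 // addr0 => /eqP.
  rewrite addrC addr_eq0 (taylor_diff_set0 _ ltI_irr) -sumrN => /eqP Eg.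
  (* Every generator of I is [z] times a variable, so dg = -df is a multiple of [z]. *)
  have Ez : DG (gpart v) set0 = z * - \sum_i fpart v [set i] * 'X_[vmon (xV a i)].
    rewrite Eg mulrN sumrN mulr_sumr; congr (- _); apply: eq_bigr => j _.
    by rewrite mulrCA -mpolyXD.
  have [h [hg zh]] := taylor_diff_div ltJ_irr monJ_z Ez.
  exists h; split=> // [W /hg|W W0]; first exact: gdeg.
  (* [h] lives on singletons, so its boundary is confined to [set0]; by degree so is [hpart v]. *)
  rewrite (@taylor_diff_deg _ _ _ _ _ 0) ?cards_eq0 // => [|W' /hg]; last exact: gdeg.
  apply/esym/eqP; apply: contraNT W0 => /hdeg/eqP.
  by rewrite cards_eq0.
have zhg W : W != set0 -> z * hpart v W = DG (gpart v) W.
  move=> W0; have /eqP := vc (inr (inl W)).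
  by rewrite dmap_g W0 subr_eq0 => /eqP.
have hc W : DG (hpart v) W = 0.
  have [->|W0] := eqVneq W set0; last first.
    by have /eqP := vc (inr (inr W)); rewrite dmap_h W0 oppr_eq0 => /eqP.
  (* The last component of [dmap v] records nothing at [set0]. There [z] times the boundary is a
     boundary of a boundary, and [z] cancels. *)
  apply: (@mulXm_inj _ _ (vmon (zV a))); rewrite mulr0 -taylor_diffM.
  by rewrite (eq_taylor_diff_pos _ _ zhg) (taylor_diff_sq _ ltJ_asym).
have [h [dh hh]] := taylor_exact ltJ_irr ltJ_asym h0 hc.
exists h; split=> [W /hh[g gW /hdeg]|W _|].
- by rewrite (cardsD1 g W) gW add1n => ->.
- exact: dh.
by rewrite dh h0 mulr0 (@taylor_diff_deg _ _ _ _ _ i.+1) // cards0.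
Qed.

Lemma dmap_exact i v : inDeg i.+1 v -> dmap v = 0 ->
  exists w : Celt k a, inDeg i.+2 w /\ dmap w = v.
Proof.
move=> vi v0; have g0 := inDeg_gpart0 vi; have hv0 := inDeg_hpart0 vi.
have f0 : fpart v set0 = 0.
  by apply/eqP/negPn/negP=> /vi /=; rewrite cards0.
have vc b : dmap v b = 0 by rewrite v0 ffunE.
have [h [hdeg dh zdh]] := lift_hpart vi v0.
have h0 : h set0 = 0 by apply/eqP/negPn/negP=> /hdeg; rewrite cards0.
(* [f1] and [g1] are the F and G components of v + d(0, 0, h), whose last component is zero by
   [dh]. *)
pose f1 V := fpart v V + Phi h V.
pose g1 W := gpart v W + - z * h W.
have f1c V : DF f1 V = 0.
  rewrite taylor_diffD; have [->|V0] := eqVneq V set0.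
    have := vc (inl set0); rewrite dmap_f eqxx Phi_set0 // addr0 -zdh.
    by rewrite Phi_chain0.
  have := vc (inl V); rewrite dmap_f (negPf V0) addr0 Phi_chain //.
  by rewrite (eq_Phi_pos V0 dh).
(* [zdh] settles [set0], where the G component of [dmap v] carries no information on dg. *)
have g1c W : DG g1 W = 0.
  rewrite taylor_diffD taylor_diffM mulNr; have [->|W0] := eqVneq W set0.
    by rewrite zdh subrr.
  by have := vc (inr (inl W)); rewrite dmap_g W0 dh.
have f10 : f1 set0 = 0 by rewrite /f1 f0 Phi_set0 // addr0.
have g10 : g1 set0 = 0 by rewrite /g1 g0 h0 mulr0 addr0.
have f1deg V : f1 V != 0 -> #|V| = i.+1.
  apply: contra_neq_eq => Vi; rewrite /f1.
  have [->|/vi/andP[_ /eqP]] := eqVneq (fpart v V) 0; last by move/eqP; rewrite (negPf Vi).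
  rewrite add0r; apply: big1 => W _; have [->|/hdeg Wi] := eqVneq (h W) 0.
    by rewrite mul0r.
  by rewrite PhiC_eq0 ?mulr0 // Wi.
have g1deg W : g1 W != 0 -> #|W| = i.+1.
  apply: contra_neq_eq => Wi; rewrite /g1.
  have [->|/vi/andP[_ /eqP]] := eqVneq (gpart v W) 0; last by move/eqP; rewrite (negPf Wi).
  rewrite add0r; have [->|/hdeg/eqP] := eqVneq (h W) 0; first by rewrite mulr0.
  by rewrite (negPf Wi).
have [F [dF Fdeg]] := taylor_exact ltI_irr ltI_asym f10 f1c.
have [H [dH Hdeg]] := taylor_exact ltJ_irr ltJ_asym g10 g1c.
(* The sign undoes the addition of d(0, 0, h); the form [- 1 * h W] lets [taylor_diffM] and [PhiM]
   apply. *)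
pose w : Celt k a := [ffun b => match b with
  | inl V => F V | inr (inl W) => H W | inr (inr W) => - 1 * h W end].
have wf V : fpart w V = F V by rewrite ffunE.
have wg W : gpart w W = H W by rewrite ffunE.
have wh W : hpart w W = - 1 * h W by rewrite ffunE.
exists w; split.
  move=> [V|[W|W]] /=; rewrite ffunE /=.
  - by case/Fdeg=> g gV /f1deg; rewrite (cardsD1 g V) gV add1n => ->.
  - case/Hdeg=> g gW /g1deg; rewrite -cards_eq0 (cardsD1 g W) gW add1n => ->.
    by rewrite eqxx.
  by rewrite mulN1r oppr_eq0 => /hdeg; rewrite -cards_eq0 => ->; rewrite eqxx.
apply/ffunP=> -[V|[W|W]]; rewrite ?dmap_f ?dmap_g ?dmap_h.
- rewrite (eq_taylor_diff _ _ wf) dF (eq_taylor_diff _ _ wg) dH g10 if_same addr0.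
  have -> : Phi (hpart w) V = - Phi h V.
    by rewrite -mulN1r -PhiM; apply: eq_bigr => W _; rewrite wh.
  by rewrite addrK.
- rewrite (eq_taylor_diff _ _ wg) dH wh mulN1r mulrN opprK.
  by case: eqP => [->|_]; rewrite /= ?h0 ?g0 ?mulr0 ?addr0 // /g1 mulNr addrNK.
rewrite (eq_taylor_diff _ _ wh) taylor_diffM mulN1r opprK.
by case: eqP => [->//|/eqP /dh].
Qed.

(** Dropping a generator removes its x_i from m_V, or its y_{i,j} from m_W, so both Taylor complexes
    are minimal. The other nonzero entries are -z and y_W with W nonempty. *)
Lemma dC_minimal (b b' : CB a) :
  CB_valid b -> CB_valid b' -> (dC k b b')@_0%MM = 0.
Proof.
have dF0 V V' : (dF k a V V')@_0%MM = 0.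
  apply: taylor_coef_minimal => u uV.
  apply/eqP=> /(congr1 (fun m : 'X_{1..nvars a} => m (enum_rank (xV a u)))).
  by rewrite !tlcm_monI /= !inE uV eqxx.
have dG0 W W' : (dG k W W')@_0%MM = 0.
  apply: taylor_coef_minimal => u uW.
  apply/eqP=> /(congr1 (fun m : 'X_{1..nvars a} => m (enum_rank (yV u)))).
  by rewrite !tlcm_monJ /= !inE uW eqxx.
case: b b' => [V|[W|W]] [V'|[W'|W']] //= W0 _; rewrite ?mcoeff0 //.
- by case: ifP; rewrite ?mcoeff0.
- by case: ifP; rewrite ?mcoeff0.
- rewrite /PhiC; case: ifP => _; rewrite ?mcoeff0 // mcoeffX.
  case: eqP => // E; have [p pW] := set0Pn _ W0.
  by have := tlcm_monY W (yV p); rewrite E mnm0E /= pW.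
- case: ifP => _; rewrite ?mcoeff0 // mcoeffN mcoeffX.
  case: eqP => [E|]; last by rewrite oppr0.
  by have := vmonE (zV a) (zV a); rewrite E mnm0E eqxx.
by case: ifP => _; rewrite ?mcoeff0 // mcoeffN dG0 oppr0.
Qed.

End DiameterFourTree.

Theorem mainTheorem7 (k : fieldType) (n : nat) (a : 'I_n -> nat) (hn : (1 <= n)%N) :
  (* d maps C_{i+1} into C_i *)
  (forall (i : nat) (v : Celt k a), inDeg (i.+1) v -> inDeg i (dmap v)) /\
  (* C is a complex: d o d = 0 *)
  (forall (i : nat) (v : Celt k a), inDeg i v -> dmap (dmap v) = 0) /\
  (* H_0(C) = Q/I_Gamma: the image of d_1 in C_0 = Q is exactly I_Gamma *)
  (forall p : Qring k a,
     in_IGamma p <->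
     exists v : Celt k a, inDeg 1 v /\ dmap v = [ffun b => if b == inl set0 then p else 0]) /\
  (* exactness at C_i, i >= 1 *)
  (forall (i : nat) (v : Celt k a), (1 <= i)%N -> inDeg i v -> dmap v = 0 ->
     exists w : Celt k a, inDeg (i.+1) w /\ dmap w = v) /\
  (* minimality: every entry of every differential lies in the homogeneous
     maximal ideal (z, x_i, y_{i,j}), i.e. has zero constant term *)
  (forall b b' : CB a, CB_valid b -> CB_valid b' -> (dC k b b')@_0%MM = 0).
Proof.
split; first exact: dmap_deg.
split; first exact: dmap_sq.
split; first exact: image_d1.
split; last exact: dC_minimal.
by case=> // i v _; apply: dmap_exact.
Qed.
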